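(* For all simplicial sets $X$, $Y$, $Z$ the following identities of maps hold: $$AW_{X,Y\times Z}\,\tilde H_{X\times Y,Z}=(1\otimes\tilde H_{Y,Z})\,AW_{X,Y\times Z}\colon C(X\times Y\times Z)\to C(X)\otimes C(Y\times Z),$$ $$AW_{X\times Y,Z}\,\tilde H_{X,Y\times Z}=(\tilde H_{X,Y}\otimes1)\,AW_{X\times Y,Z}\colon C(X\times Y\times Z)\to C(X\times Y)\otimes C(Z).$$
   Context: $\Bbbk$ is a commutative ring with unit; $C(X)$ is the normalized chain complex of a simplicial set $X$ over $\Bbbk$. The Koszul sign rule is used, e.g. $(1\otimes h)(x\otimes c)=(-1)^{|h||x|}x\otimes h(c)$. For a simplex $x$ write $\partial_p^qx=\partial_p\partial_{p+1}\cdots\partial_qx$ for $p\le q$ and $\partial_p^{p-1}x=x$. For a set $\alpha=\{\alpha_1<\dots<\alpha_p\}$ of non-negative integers write $s_\alpha x=s_{\alpha_p}\cdots s_{\alpha_1}x$, $s_\emptyset x=x$. A $(p,q)$-shuffle $(\alpha,\beta)\vdash(p,q)$ is a partition of $\{0,\dots,p+q-1\}$ into sets $\alpha,\beta$ of sizes $p,q$; $(-1)^{(\alpha,\beta)}$ is the sign of the permutation $(\alpha_1<\dots<\alpha_p,\beta_1<\dots<\beta_q)$. The Alexander--Whitney map is $AW_{X,Y}\colon C(X\times Y)\to C(X)\otimes C(Y)$, $AW(x,y)=\sum_{k=0}^n\partial_{k+1}^nx\otimes\partial_0^{k-1}y$ for $(x,y)\in X_n\times Y_n$. The map $\tilde H_{X,Y}\colon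 C(X\times Y)\to C(X\times Y)$ (degree $+1$) is, for $(x,y)\in X_n\times Y_n$, $$\tilde H(x,y)=\sum_{p,q\ge0,\;p+q<n}\ \sum_{(\alpha,\beta)\vdash(p,q+1)}(-1)^{p+q+(\alpha,\beta)}\bigl(s_\beta\,\partial_{p+1}^{p+q}x,\ s_{p+q+1}s_\alpha\,\partial_0^{p-1}y\bigr).$$ $\tilde H_{X\times Y,Z}$ and $\tilde H_{X,Y\times Z}$ (and similarly the $AW$ maps) arise from regarding $X\times Y\times Z$ as $(X\times Y)\times Z$ and $X\times(Y\times Z)$, respectively. *)

(* Defs.v *)
From HB Require Import structures.
From mathcomp Require Import all_boot all_order all_algebra all_fingroup.
From mathcomp Require Import mathcomp_extra boolp classical_sets functions.
From mathcomp Require Import cardinality fsbigop zify.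

Set Implicit Arguments.
Unset Strict Implicit.
Unset Printing Implicit Defensive.

Import GRing.Theory.
Local Open Scope ring_scope.

Section FreeModule.
Variables (R : pzRingType) (T : choiceType).

Definition finsupp : {pred T -> R^o} :=
  fun f => `[< finite_set [set t | f t <> 0] >].

Lemma finsupp_submod_closed : submod_closed finsupp.
Proof.
split.
  rewrite unfold_in; apply/asboolP.
  by rewrite (_ : mkset _ = set0)%classic // -subset0 => t /=.
move=> a f g /asboolP finf /asboolP fing; apply/asboolP.
apply: (@sub_finite_set _ _ ([set t | f t <> 0] `|` [set t | g t <> 0])%classic).
  move=> t /= fgt; case: (pselect (f t = 0)) => [ft0|]; last by left.
  right=> gt0; apply: fgt; rewrite -[LHS]/(a *: f t + g t).
  by rewrite ft0 gt0 scaler0 addr0.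
by rewrite finite_setU.
Qed.

HB.instance Definition _ :=
  GRing.isSubmodClosed.Build R (T -> R^o) finsupp finsupp_submod_closed.

(* the free R-module on T: functions of finite support *)
Record freemod := Freemod
  { freemod_val :> T -> R^o; _ : freemod_val \in finsupp }.

HB.instance Definition _ := [isSub for freemod_val].
HB.instance Definition _ := [Choice of freemod by <:].
HB.instance Definition _ := [SubChoice_isSubLmodule of freemod by <:].

Lemma freegen_finsupp t : (fun u => (u == t)%:R) \in finsupp.
Proof.
rewrite unfold_in; apply/asboolP/(@sub_finite_set _ _ [set t]%classic) => //.
by move=> u /=; case: eqP.
Qed.

Definition freegen (t : T) : freemod := Freemod (freegen_finsupp t).

Definition freelift (M : lmodType R) (f : T -> M) (c : freemod) : M :=
  \sum_(t \in [set: T]) (c t : R) *: f t.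

Lemma freeliftE (M : lmodType R) (f : T -> M) (c : freemod) (r : seq T) :
  uniq r -> (forall t, c t != 0 -> t \in r) ->
  freelift f c = \sum_(t <- r) (c t : R) *: f t.
Proof.
move=> r_uniq cr; rewrite /freelift (fsbigE r) //=.
  by apply: eq_bigl => t; rewrite in_setT.
move=> t _ tr; apply/eqP; apply: contraNT tr => ct0; apply: cr.
by apply: contraNneq ct0 => ->; rewrite scale0r.
Qed.

Lemma freemod_supp (c : freemod) :
  exists2 r : seq T, uniq r & forall t, c t != 0 -> t \in r.
Proof.
have /asboolP /finite_seqP[r cr] : freemod_val c \in finsupp := valP c.
exists (undup r); first exact: undup_uniq.
move=> t /eqP ct; rewrite mem_undup.
by have : [set` r]%classic t by rewrite -cr.
Qed.

Lemma freelift_linear (M : lmodType R) (f : T -> M) : linear (freelift f).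
Proof.
move=> a c d; have [r ur cr] := freemod_supp c; have [s us ds] := freemod_supp d.
have rs t : (t \in undup (r ++ s)) = (t \in r) || (t \in s).
  by rewrite mem_undup mem_cat.
have cdE t : (a *: c + d) t = a * c t + d t by [].
rewrite !(@freeliftE _ _ _ (undup (r ++ s)) (undup_uniq _)).
- rewrite scaler_sumr -big_split /=; apply: eq_bigr => t _.
  by rewrite -[LHS]/((a * c t + d t : R) *: f t) scalerDl scalerA.
- by move=> t /ds; rewrite rs => ->; rewrite orbT.
- by move=> t /cr; rewrite rs => ->.
move=> t; rewrite cdE rs; apply: contraR; rewrite negb_or => /andP[tr ts].
have -> : c t = 0 by apply/eqP; apply: contraNT tr; exact: cr.
have -> : d t = 0 by apply/eqP; apply: contraNT ts; exact: ds.
by rewrite mulr0 addr0.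
Qed.

HB.instance Definition _ (M : lmodType R) (f : T -> M) :=
  GRing.isLinear.Build R freemod M _ (freelift f) (freelift_linear f).

Lemma freelift_gen (M : lmodType R) (f : T -> M) t :
  freelift f (freegen t) = f t.
Proof.
rewrite (@freeliftE _ _ _ [:: t]) //.
  by rewrite big_seq1 -[LHS]/(((t == t)%:R : R) *: f t) eqxx scale1r.
move=> u; rewrite mem_seq1 => ut; apply: contraNT ut => /negPf ut.
by rewrite -[freegen t u]/((u == t)%:R : R) ut.
Qed.

Lemma freemodE (c : freemod) : c = freelift freegen c.
Proof.
have [r ur cr] := freemod_supp c; rewrite (freeliftE _ ur cr).
apply/val_inj/funext => t; rewrite (raddf_sum (val : freemod -> _)) fct_sumE /=.
rewrite (_ : \sum_(u <- r) _ = \sum_(u <- r) (c u : R) * (t == u)%:R); last first.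
  exact: eq_bigr.
case: (boolP (t \in r)) => [tr|tr].
  rewrite (bigD1_seq t) //= eqxx mulr1 big1 ?addr0 // => u /negPf.
  by rewrite eq_sym => ->; rewrite mulr0.
rewrite big1_seq; first by apply/eqP; apply: contraNT tr; exact: cr.
move=> u /= ur'; case: eqP => [tu|_]; last by rewrite mulr0.
by rewrite tu ur' in tr.
Qed.

Lemma freelift_unique (M : lmodType R) (f g : {linear freemod -> M}) :
  (forall t, f (freegen t) = g (freegen t)) -> f =1 g.
Proof.
move=> fg c; have [r ur cr] := freemod_supp c.
rewrite (freemodE c) (freeliftE _ ur cr) !linear_sum.
by apply: eq_bigr => t _; rewrite !linearZ fg.
Qed.

End FreeModule.

Section QuotientModule.
Variables (R : pzRingType) (M : lmodType R) (S : set M).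

Inductive span : M -> Prop :=
| span0 : span 0
| spanDZ a x y : S x -> span y -> span (a *: x + y).

Definition spanp : {pred M} := fun x => `[< span x >].

Lemma spanp_submod_closed : submod_closed spanp.
Proof.
have spanD x y : span x -> span y -> span (x + y).
  by move=> sx sy; elim: sx => [|a z t Sz _ IH]; rewrite ?add0r // -addrA; constructor.
have spanZ a x : span x -> span (a *: x).
  elim=> [|b z t Sz _ IH]; first by rewrite scaler0; constructor.
  by rewrite scalerDr scalerA; constructor.
split; first by rewrite unfold_in; apply/asboolP; constructor.
move=> a x y /asboolP sx /asboolP sy; apply/asboolP.
exact: spanD (spanZ _ _ sx) sy.
Qed.

HB.instance Definition _ :=
  GRing.isSubmodClosed.Build R M spanp spanp_submod_closed.

(* the quotient of M by the submodule generated by S *)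
Definition quotmod := Quotient.quot spanp.
HB.instance Definition _ := EqQuotient.on quotmod.
HB.instance Definition _ := GRing.Zmodule.on quotmod.

Definition qclass (x : M) : quotmod := (\pi_(Quotient.quot spanp) x)%qT.

Lemma qclass_eq x y : (qclass x = qclass y) <-> span (x - y).
Proof.
split=> [|sxy].
  by move/eqP; rewrite /qclass -Quotient.idealrBE => /asboolP.
by apply/eqP; rewrite /qclass -Quotient.idealrBE; apply/asboolP.
Qed.

Lemma qclass_surj (c : quotmod) : exists x, c = qclass x.
Proof. by exists (generic_quotient.repr c); rewrite /qclass reprK. Qed.

Lemma qclassD x y : qclass (x + y) = qclass x + qclass y.
Proof. exact: (Quotient.pi_add spanp). Qed.

Lemma span_scale a x : span x -> span (a *: x).
Proof. by move=> /asboolP sx; apply/asboolP; apply: (@rpredZ R M spanp). Qed.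

Definition quotmod_scale (a : R) (c : quotmod) : quotmod :=
  qclass (a *: generic_quotient.repr c).

Lemma quotmod_scaleE a x : quotmod_scale a (qclass x) = qclass (a *: x).
Proof.
apply/qclass_eq; rewrite -scalerBr; apply/span_scale/qclass_eq.
by rewrite /qclass reprK.
Qed.

Fact quotmod_scalerA a b c :
  quotmod_scale a (quotmod_scale b c) = quotmod_scale (a * b) c.
Proof. by case: (qclass_surj c) => x ->; rewrite !quotmod_scaleE scalerA. Qed.

Fact quotmod_scale1r : left_id 1 quotmod_scale.
Proof. by move=> c; case: (qclass_surj c) => x ->; rewrite quotmod_scaleE scale1r. Qed.

Fact quotmod_scalerDr : right_distributive quotmod_scale +%R.
Proof.
move=> a c d; case: (qclass_surj c) => x ->; case: (qclass_surj d) => y ->.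
by rewrite -qclassD !quotmod_scaleE scalerDr qclassD.
Qed.

Fact quotmod_scalerDl c : {morph quotmod_scale^~ c : a b / a + b}.
Proof.
by case: (qclass_surj c) => x -> a b; rewrite !quotmod_scaleE scalerDl qclassD.
Qed.

HB.instance Definition _ := GRing.Zmodule_isLmodule.Build R quotmod
  quotmod_scalerA quotmod_scale1r quotmod_scalerDr quotmod_scalerDl.

Lemma qclass_linear : linear qclass.
Proof. by move=> a x y; rewrite qclassD -quotmod_scaleE. Qed.

HB.instance Definition _ := GRing.isLinear.Build R M quotmod _ qclass qclass_linear.

Lemma qclass_rel x : S x -> qclass x = 0.
Proof.
move=> Sx; rewrite -(linear0 qclass); apply/qclass_eq.
by rewrite subr0 -[x]addr0 -[x]scale1r; do 2?constructor.
Qed.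

Section Lift.
Variables (P : lmodType R) (f : {linear M -> P}).

Definition qlift (_ : forall x, S x -> f x = 0) (c : quotmod) : P :=
  f (generic_quotient.repr c).

Hypothesis f_rel : forall x, S x -> f x = 0.

Lemma qlift_class x : qlift f_rel (qclass x) = f x.
Proof.
apply/eqP; rewrite /qlift -subr_eq0 -linearB; apply/eqP.
have : span (generic_quotient.repr (qclass x) - x) by apply/qclass_eq; rewrite /qclass reprK.
elim=> [|a z t Sz _ IH]; first by rewrite linear0.
by rewrite linearP IH f_rel // scaler0 addr0.
Qed.

Lemma qlift_linear : linear (qlift f_rel).
Proof.
move=> a c d; case: (qclass_surj c) => x ->; case: (qclass_surj d) => y ->.
by rewrite -linearP !qlift_class linearP.
Qed.

HB.instance Definition _ :=
  GRing.isLinear.Build R quotmod P _ (qlift f_rel) qlift_linear.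

End Lift.

Lemma quotmod_hom_eq (P : lmodType R) (f g : {linear quotmod -> P}) :
  (forall x, f (qclass x) = g (qclass x)) -> f =1 g.
Proof. by move=> fg c; case: (qclass_surj c) => x ->. Qed.

End QuotientModule.

Section TensorProduct.
Variable R : comPzRingType.

Section Def.
Variables M N : lmodType R.

Inductive tensor_rel : set (freemod R (M * N)%type) :=
| tensor_relDl m m' n :
    tensor_rel (freegen R (m + m', n) - freegen R (m, n) - freegen R (m', n))
| tensor_relDr m n n' :
    tensor_rel (freegen R (m, n + n') - freegen R (m, n) - freegen R (m, n'))
| tensor_relZl a m n :
    tensor_rel (freegen R (a *: m, n) - a *: freegen R (m, n))
| tensor_relZr a m n :
    tensor_rel (freegen R (m, a *: n) - a *: freegen R (m, n)).

Definition tensor := quotmod tensor_rel.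
HB.instance Definition _ := GRing.Lmodule.on tensor.

Definition tens (m : M) (n : N) : tensor := qclass tensor_rel (freegen R (m, n)).

Lemma tensDl m m' n : tens (m + m') n = tens m n + tens m' n.
Proof.
apply/eqP; rewrite -subr_eq0 opprD addrA /tens -!linearB /=; apply/eqP.
by apply/qclass_rel/tensor_relDl.
Qed.

Lemma tensDr m n n' : tens m (n + n') = tens m n + tens m n'.
Proof.
apply/eqP; rewrite -subr_eq0 opprD addrA /tens -!linearB /=; apply/eqP.
by apply/qclass_rel/tensor_relDr.
Qed.

Lemma tensZl a m n : tens (a *: m) n = a *: tens m n.
Proof.
apply/eqP; rewrite -subr_eq0 /tens -linearZ -linearB /=; apply/eqP.
by apply/qclass_rel/tensor_relZl.
Qed.

Lemma tensZr a m n : tens m (a *: n) = a *: tens m n.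
Proof.
apply/eqP; rewrite -subr_eq0 /tens -linearZ -linearB /=; apply/eqP.
by apply/qclass_rel/tensor_relZr.
Qed.

Lemma tens0l n : tens 0 n = 0.
Proof. by rewrite -[X in tens X _](scale0r 0) tensZl scale0r. Qed.

Lemma tens0r m : tens m 0 = 0.
Proof. by rewrite -[X in tens _ X](scale0r 0) tensZr scale0r. Qed.

Lemma tensor_hom_eq (P : lmodType R) (f g : {linear tensor -> P}) :
  (forall m n, f (tens m n) = g (tens m n)) -> f =1 g.
Proof.
move=> fg; apply: quotmod_hom_eq => x.
exact: (@freelift_unique _ _ _ (f \o qclass tensor_rel) (g \o qclass tensor_rel)
          (fun t => let: (m, n) := t in fg m n)).
Qed.

Section Lift.
Variables (P : lmodType R) (h : M -> N -> P).
Hypothesis hDl : forall m m' n, h (m + m') n = h m n + h m' n.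
Hypothesis hDr : forall m n n', h m (n + n') = h m n + h m n'.
Hypothesis hZl : forall a m n, h (a *: m) n = a *: h m n.
Hypothesis hZr : forall a m n, h m (a *: n) = a *: h m n.

Let hp (mn : M * N) := h mn.1 mn.2.

Fact tensor_lift_rel x : tensor_rel x -> freelift hp x = 0.
Proof.
case=> [m m' n|m n n'|a m n|a m n]; rewrite !linearB ?linearZ /= !freelift_gen /hp /=.
- by rewrite hDl -addrA -opprD; apply: subrr.
- by rewrite hDr -addrA -opprD; apply: subrr.
- by rewrite hZl scalerN; apply: subrr.
- by rewrite hZr scalerN; apply: subrr.
Qed.

Definition tensor_lift : {linear tensor -> P} := qlift tensor_lift_rel.

Lemma tensor_liftE m n : tensor_lift (tens m n) = h m n.
Proof. exact: etrans (qlift_class tensor_lift_rel _) (freelift_gen _ _). Qed.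
End Lift.

End Def.

Section Map.
Variables M M' N N' : lmodType R.
Variables (f : {linear M -> M'}) (g : {linear N -> N'}).

Let h m n : tensor M' N' := tens (f m) (g n).

Fact tmap_Dl m m' n : h (m + m') n = h m n + h m' n.
Proof. by rewrite /h linearD tensDl. Qed.
Fact tmap_Dr m n n' : h m (n + n') = h m n + h m n'.
Proof. by rewrite /h linearD tensDr. Qed.
Fact tmap_Zl a m n : h (a *: m) n = a *: h m n.
Proof. by rewrite /h linearZ tensZl. Qed.
Fact tmap_Zr a m n : h m (a *: n) = a *: h m n.
Proof. by rewrite /h linearZ tensZr. Qed.

Definition tensor_map : {linear tensor M N -> tensor M' N'} :=
  tensor_lift tmap_Dl tmap_Dr tmap_Zl tmap_Zr.

Lemma tensor_mapE m n : tensor_map (tens m n) = tens (f m) (g n).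
Proof. exact: tensor_liftE. Qed.
End Map.

End TensorProduct.

Section SimplexCategory.

Record mono (m n : nat) := Mono {
  mono_fun :> {ffun 'I_m.+1 -> 'I_n.+1};
  _ : [forall i : 'I_m.+1, forall j : 'I_m.+1,
         (i <= j)%N ==> (mono_fun i <= mono_fun j)%N]
}.
HB.instance Definition _ m n := [isSub for @mono_fun m n].

Lemma monoP m n (f : mono m n) (i j : 'I_m.+1) : (i <= j)%N -> (f i <= f j)%N.
Proof. by move: (valP f) => /= /forallP/(_ i)/forallP/(_ j)/implyP. Qed.

Fact mk_mono_subproof m n (f : 'I_m.+1 -> 'I_n.+1)
    (fP : forall i j : 'I_m.+1, (i <= j)%N -> (f i <= f j)%N) :
  [forall i : 'I_m.+1, forall j : 'I_m.+1,
    (i <= j)%N ==> ([ffun i => f i] i <= [ffun i => f i] j)%N].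
Proof.
by apply/forallP => i; apply/forallP => j; apply/implyP; rewrite !ffunE; apply: fP.
Qed.

Definition mk_mono m n (f : 'I_m.+1 -> 'I_n.+1) fP : mono m n :=
  Mono (@mk_mono_subproof m n f fP).

Lemma mk_monoE m n f fP : @mk_mono m n f fP =1 f.
Proof. by move=> i; rewrite /= ffunE. Qed.

Lemma mono_eq m n (f g : mono m n) : (forall i, f i = g i :> nat) -> f = g.
Proof. by move=> fg; apply/val_inj/ffunP => i; apply: ord_inj. Qed.

Definition mono_id n : mono n n := @mk_mono n n id (fun _ _ => id).

Fact mono_comp_subproof m n p (f : mono n p) (g : mono m n) (i j : 'I_m.+1) :
  (i <= j)%N -> (f (g i) <= f (g j))%N.
Proof. by move=> ij; apply/monoP/monoP. Qed.

Definition mono_comp m n p (f : mono n p) (g : mono m n) : mono m p :=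
  mk_mono (mono_comp_subproof f g).

Fact coface_subproof n (i : 'I_n.+2) (j k : 'I_n.+1) :
  (j <= k)%N -> (lift i j <= lift i k)%N.
Proof. by rewrite /= /bump => jk; case: leqP; case: leqP; lia. Qed.

(* the injection [n] -> [n+1] that misses i *)
Definition coface n (i : 'I_n.+2) : mono n n.+1 := mk_mono (@coface_subproof n i).

Fact unbump_ord n (i : 'I_n.+1) (j : 'I_n.+2) : (unbump i j < n.+1)%N.
Proof. by rewrite /unbump; case: ltnP; have := ltn_ord j; have := ltn_ord i; lia. Qed.

Fact codegen_subproof n (i : 'I_n.+1) (j k : 'I_n.+2) :
  (j <= k)%N -> (Ordinal (unbump_ord i j) <= Ordinal (unbump_ord i k))%N.
Proof. by rewrite /= /unbump => jk; case: ltnP; case: ltnP; lia. Qed.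

(* the surjection [n+1] -> [n] that takes the value i twice *)
Definition codegen n (i : 'I_n.+1) : mono n.+1 n := mk_mono (@codegen_subproof n i).

End SimplexCategory.

Record sset := SSet {
  simp :> nat -> Type;
  act : forall m n, mono m n -> simp n -> simp m;
  act_id : forall n (x : simp n), act (mono_id n) x = x;
  act_comp : forall m n p (f : mono n p) (g : mono m n) (x : simp p),
    act (mono_comp f g) x = act g (act f x)
}.
Arguments act s {m n} f x.

Section Simplices.
Variable X : sset.

(* simplices of all dimensions, the dimension of t being [tag t]; the iterated
   operators below then need no transport between equal dimensions *)
Definition simplex := {n : nat & X n}.

(* outside the range i <= tag t (and, for faces, 0 < tag t), which the formulas
   below never leave, the values of [face] and [degen] are arbitrary *)
Definition face (i : nat) (t : simplex) : simplex :=
  match t with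
  | existT 0 x => existT X 0 x
  | existT n.+1 x => existT X n (act X (coface (inord i)) x)
  end.

Definition degen (i : nat) (t : simplex) : simplex :=
  existT X (tag t).+1 (act X (codegen (inord i)) (tagged t)).

(* faces p q is $\partial_p \partial_{p+1} \cdots \partial_{q-1}$, with upper
   end excluded, so that the empty composite includes $\partial_0^{-1}$ *)
Definition faces (p q : nat) (t : simplex) : simplex :=
  foldr face t (index_iota p q).

(* the smallest index is applied first; [enum] lists a set of ordinals in
   increasing order *)
Definition degens m (a : {set 'I_m}) (t : simplex) : simplex :=
  foldl (fun u i => degen i u) t [seq val i | i <- enum a].

End Simplices.

Section Products.
Variables X Y : sset.

Let pact m n (f : mono m n) (xy : X n * Y n) : X m * Y m :=
  (act X f xy.1, act Y f xy.2).

Fact prod_act_id n xy : pact (mono_id n) xy = xy.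
Proof. by case: xy => x y; rewrite /pact !act_id. Qed.

Fact prod_act_comp m n p (f : mono n p) (g : mono m n) xy :
  pact (mono_comp f g) xy = pact g (pact f xy).
Proof. by rewrite /pact !act_comp. Qed.

Definition sprod : sset := SSet prod_act_id prod_act_comp.

Definition simplex1 (t : simplex sprod) : simplex X := existT X (tag t) (tagged t).1.
Definition simplex2 (t : simplex sprod) : simplex Y := existT Y (tag t) (tagged t).2.

End Products.

Record smap (X Y : sset) := SMap {
  smap_fun :> forall n, X n -> Y n;
  smap_nat : forall m n (f : mono m n) (x : X n),
    smap_fun (act X f x) = act Y f (smap_fun x)
}.

Definition sassoc X Y Z : smap (sprod (sprod X Y) Z) (sprod X (sprod Y Z)) :=
  @SMap (sprod (sprod X Y) Z) (sprod X (sprod Y Z))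
    (fun n xyz => (xyz.1.1, (xyz.1.2, xyz.2))) (fun _ _ _ _ => erefl).

Definition sassocV X Y Z : smap (sprod X (sprod Y Z)) (sprod (sprod X Y) Z) :=
  @SMap (sprod X (sprod Y Z)) (sprod (sprod X Y) Z)
    (fun n xyz => ((xyz.1, xyz.2.1), xyz.2.2)) (fun _ _ _ _ => erefl).

Definition smap_simplex X Y (f : smap X Y) (t : simplex X) : simplex Y :=
  existT Y (tag t) (f (tag t) (tagged t)).

Section Chains.
Variable k : comPzRingType.

Section Def.
Variable X : sset.

Definition degenerate_chains : set (freemod k {classic (simplex X)}) :=
  [set c | exists (t : simplex X) (i : nat),
             (i <= tag t)%N /\ c = freegen k (degen i t : {classic _})]%classic.

(* $\bigoplus_n C_n(X)$ with $C_n(X)$ the free module on the n-simplices modulo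
   the degenerate ones. As all maps are given by explicit formulas on simplices,
   the grading only enters through the Koszul sign, and the differential not at
   all. The tensor product of graded modules is that of the total modules. *)
Definition chain := quotmod degenerate_chains.
HB.instance Definition _ := GRing.Lmodule.on chain.

Definition chain_of (t : simplex X) : chain :=
  qclass degenerate_chains (freegen k (t : {classic _})).

Lemma chain_of_degen t i : (i <= tag t)%N -> chain_of (degen i t) = 0.
Proof. by move=> it; apply: qclass_rel; exists t, i. Qed.

Section Lift.
Variables (M : lmodType k) (h : simplex X -> M).
Hypothesis h_degen : forall t i, (i <= tag t)%N -> h (degen i t) = 0.

Fact chain_lift_rel c :
  degenerate_chains c -> freelift (h : {classic _} -> M) c = 0.
Proof. by case=> t [i [it ->]]; rewrite freelift_gen h_degen. Qed.

Definition chain_lift : {linear chain -> M} := qlift chain_lift_rel.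

Lemma chain_liftE t : chain_lift (chain_of t) = h t.
Proof. exact: etrans (qlift_class chain_lift_rel _) (freelift_gen _ _). Qed.
End Lift.

Lemma chain_hom_eq (M : lmodType k) (f g : {linear chain -> M}) :
  (forall t, f (chain_of t) = g (chain_of t)) -> f =1 g.
Proof.
move=> fg; apply: quotmod_hom_eq => x.
exact: (@freelift_unique _ _ _ (f \o qclass _) (g \o qclass _) fg).
Qed.

(* $x \mapsto (-1)^{d |x|} x$ *)
Section Sign.
Variable d : nat.
Let h (t : simplex X) : chain := (-1) ^+ (d * tag t) *: chain_of t.

Fact chain_sign_degen t i : (i <= tag t)%N -> h (degen i t) = 0.
Proof. by move=> it; rewrite /h chain_of_degen // scaler0. Qed.

Definition chain_sign : {linear chain -> chain} := chain_lift chain_sign_degen.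
End Sign.

End Def.

Section Map.
Variables (X Y : sset) (f : smap X Y).
Let h (t : simplex X) : chain Y := chain_of (smap_simplex f t).

Fact chain_map_degen t i : (i <= tag t)%N -> h (degen i t) = 0.
Proof.
move=> it; rewrite /h (_ : smap_simplex _ _ = degen i (smap_simplex f t)).
  exact: chain_of_degen.
by rewrite /smap_simplex /degen /= smap_nat.
Qed.

Definition chain_map : {linear chain X -> chain Y} := chain_lift chain_map_degen.
End Map.

(* $f \otimes g$ for g homogeneous of degree d:
   $x \otimes c \mapsto (-1)^{d |x|} f(x) \otimes g(c)$ *)
Definition koszul X (M N N' : lmodType k) (d : nat)
    (f : {linear chain X -> M}) (g : {linear N -> N'}) :
    {linear tensor (chain X) N -> tensor M N'} :=
  tensor_map (f \o chain_sign X d) g.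

Lemma koszulE X (M N N' : lmodType k) d (f : {linear chain X -> M})
    (g : {linear N -> N'}) (t : simplex X) (c : N) :
  koszul d f g (tens (chain_of t) c) =
  (-1) ^+ (d * tag t) *: tens (f (chain_of t)) (g c).
Proof.
have signE : chain_sign X d (chain_of t) = (-1) ^+ (d * tag t) *: chain_of t.
  exact: chain_liftE.
rewrite /koszul tensor_mapE -tensZl -linearZ.
exact: (congr1 (fun u => tens (f u) (g c)) signE).
Qed.

End Chains.

Section Operators.
Variable X : sset.
Implicit Types (t u : simplex X).

(* u is obtained from t by the simplicial operator with vertex map f *)
Definition induced u t (f : nat -> nat) : Prop :=
  exists2 th : mono (tag u) (tag t),
    tagged u = act X th (tagged t) & forall j, th j = f j :> nat.

Lemma induced_refl t : induced t t id.
Proof.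
by exists (mono_id (tag t)) => [|j]; rewrite ?mk_monoE // act_id.
Qed.

Lemma induced_act u t f m (g : mono m (tag u)) (h : nat -> nat) :
  induced u t f -> (forall j, g j = h j :> nat) ->
  induced (existT X m (act X g (tagged u))) t (f \o h).
Proof.
case=> th uE thE gE; exists (mono_comp th g) => /= [|j].
  by rewrite act_comp uE.
by rewrite ffunE thE gE.
Qed.

Lemma induced_ext u t f g :
  (forall j, (j <= tag u)%N -> f j = g j) -> induced u t f -> induced u t g.
Proof. by move=> fg [th uE thE]; exists th => // j; rewrite thE fg // -ltnS. Qed.

Lemma induced_face i u t f : (i <= tag u)%N -> (0 < tag u)%N ->
  induced u t f -> induced (face i u) t (f \o bump i).
Proof.
case: u => [[|n] x] //= iu _ ind.
by apply: (@induced_act (existT X n.+1 x)) => // j; rewrite mk_monoE /= inordK.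
Qed.

Lemma induced_degen i u t f : (i <= tag u)%N ->
  induced u t f -> induced (degen i u) t (f \o unbump i).
Proof.
by move=> iu ind; apply: induced_act => // j; rewrite mk_monoE /= inordK.
Qed.

Lemma tag_face i t : tag (face i t) = (tag t).-1.
Proof. by case: t => [[|n] x]. Qed.

Lemma tag_faces p q t : tag (faces p q t) = (tag t - (q - p))%N.
Proof.
rewrite /faces /index_iota; move: (q - p)%N => m; elim: m p => [|m IH] p /=; first by rewrite subn0.
by rewrite tag_face IH; lia.
Qed.

Lemma tag_degens m (a : {set 'I_m}) t : tag (degens a t) = (tag t + #|a|)%N.
Proof.
rewrite /degens cardE -(size_map val (enum a)).
elim: [seq val i | i <- enum a] t => [|i s IH] t /=; first by rewrite addn0.
by rewrite IH /= addSnnS.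
Qed.

Lemma induced_faces p q t : (q <= (tag t).+1)%N -> (q - p <= tag t)%N ->
  induced (faces p q t) t (fun j => if (j < p)%N then j else j + (q - p))%N.
Proof.
move=> qt qpt.
case: (leqP p q) => [pq|/ltnW qp]; last first.
  rewrite /faces /index_iota (eqP qp) /=; apply: induced_ext (induced_refl t) => j _.
  by rewrite addn0 if_same.
have -> : q = (p + (q - p))%N by lia.
have : (p + (q - p) <= (tag t).+1)%N by lia.
move: (q - p)%N qpt => m {q qt pq}; rewrite addKn.
elim: m p => [|m IH] p mt pmt.
  rewrite addn0 /faces /index_iota subnn /=.
  by apply: induced_ext (induced_refl t) => j _; rewrite addn0 if_same.
have fE : faces p (p + m.+1) t = face p (faces p.+1 (p.+1 + m) t).
  by rewrite /faces /index_iota !addKn.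
have tE := tag_faces p.+1 (p.+1 + m) t; rewrite addKn in tE.
rewrite fE; apply: induced_ext (induced_face _ _ (IH p.+1 _ _)); try lia.
by move=> j _ /=; rewrite /bump; case: (leqP p j) => pj /=; case: ltnP; lia.
Qed.

Definition below (s : seq nat) (j : nat) := count (fun b => (b < j)%N) s.

Lemma below_iotaS s j : uniq s -> below s j.+1 = (below s j + (j \in s))%N.
Proof.
move=> us; rewrite /below -count_uniq_mem //; elim: s {us} => //= b s ->.
by rewrite ltnS leq_eqVlt; case: (ltngtP b j) => _ /=; lia.
Qed.

Lemma below_all s j : all (fun b => b < j)%N s -> below s j = size s.
Proof. by rewrite all_count => /eqP. Qed.

Lemma induced_degen_seq s t : sorted ltn s -> all (fun b => b < tag t + size s)%N s ->
  induced (foldl (fun u i => degen i u) t s) t (fun j => j - below s j)%N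
  /\ tag (foldl (fun u i => degen i u) t s) = (tag t + size s)%N.
Proof.
elim/last_ind: s => [|s i IH] ss sb.
  by split; [apply: induced_ext (induced_refl t) => j _; rewrite subn0|rewrite addn0].
have si : all (fun b => b < i)%N s.
  by move: ss; rewrite (sorted_pairwise ltn_trans) pairwise_rcons => /andP[].
have {}ss : sorted ltn s.
  by move: ss; rewrite !(sorted_pairwise ltn_trans) pairwise_rcons => /andP[].
move: sb; rewrite all_rcons size_rcons => /andP[it _].
have sb : all (fun b => b < tag t + size s)%N s.
  by apply: sub_all si => b; lia.
have [ind tE] := IH ss sb; rewrite -cats1 foldl_cat /= tE; split; last by rewrite addnS.
apply: induced_ext (induced_degen _ ind); last by rewrite tE; lia.
move=> j _ /=; rewrite /unbump /below count_cat /= addn0.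
case: (ltnP i j) => ij /=; last by rewrite subn0 addn0.
rewrite -!/(below _ _) !below_all; first by lia.
  by apply: sub_all si => b; lia.
by apply: sub_all si => b; lia.
Qed.

Definition belows m (a : {set 'I_m}) := below [seq val i | i <- enum a].

Lemma enum_sorted m (a : {set 'I_m}) : sorted ltn [seq val i | i <- enum a].
Proof.
apply: (@subseq_sorted _ ltn ltn_trans _ (iota 0 m)); last exact: iota_ltn_sorted.
by rewrite -val_enum_ord; apply: map_subseq; rewrite enumT; exact: filter_subseq.
Qed.

Lemma induced_degens m (a : {set 'I_m}) t : (m <= tag t + #|a|)%N ->
  induced (degens a t) t (fun j => j - belows a j)%N.
Proof.
move=> mt; apply: (proj1 (induced_degen_seq (enum_sorted a) _)).
rewrite size_map -cardE; apply/allP => _ /mapP[i _ ->].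
by apply: leq_trans (ltn_ord i) mt.
Qed.

Lemma induced_trans u v t f g :
  induced u v g -> induced v t f -> induced u t (f \o g).
Proof.
case: u => n x [th /= -> thE] ind.
exact: (@induced_act v t f n th).
Qed.

Lemma induced_merge m u t f i : tag u = m.+1 -> (i <= m)%N ->
  induced u t f -> f i = f i.+1 -> exists2 v, tag v = m & u = degen i v.
Proof.
case: u => n x /= nm im [th /= xE thE] fi; case: _ / (esym nm) in x th xE thE *.
pose v := existT X m (act X (mono_comp th (coface (inord i))) (tagged t)).
exists v => //; rewrite /v /degen /= -act_comp xE; congr existT; congr act.
apply: mono_eq => j; rewrite !ffunE /= !thE /= !inordK // ?ltnS // ?leqW //.
rewrite /bump /unbump; have := ltn_ord j.
case: (ltngtP i j) => ij jm /=.
- by congr f; case: leqP; lia.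
- by congr f; case: leqP; lia.
by rewrite -ij subn0 leqnn add1n.
Qed.

End Operators.

Lemma simplex1_degen X Y i (t : simplex (sprod X Y)) :
  simplex1 (degen i t) = degen i (simplex1 t).
Proof. by []. Qed.

Lemma simplex2_degen X Y i (t : simplex (sprod X Y)) :
  simplex2 (degen i t) = degen i (simplex2 t).
Proof. by []. Qed.

Section AlexanderWhitney.
Variables (k : comPzRingType) (X Y : sset).

Definition aw_simplex (t : simplex (sprod X Y)) :
    tensor (chain k X) (chain k Y) :=
  \sum_(i < (tag t).+1)
    tens (chain_of k (faces i.+1 (tag t).+1 (simplex1 t)))
         (chain_of k (faces 0 i (simplex2 t))).

Fact aw_simplex_degen t j : (j <= tag t)%N -> aw_simplex (degen j t) = 0.
Proof.
case: t => n [x y] jn; rewrite /= in jn; apply: big1 => -[i /= it] _.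
set a := degen j (existT X n x); set b := degen j (existT Y n y).
rewrite -[LHS]/(tens (chain_of k (faces i.+1 n.+2 a)) (chain_of k (faces 0 i b))).
have ta : tag a = n.+1 by []; have tb : tag b = n.+1 by [].
have inda := @induced_degen X j (existT X n x) _ _ jn (induced_refl _).
have indb := @induced_degen Y j (existT Y n y) _ _ jn (induced_refl _).
case: (ltnP j i) => ji.
  have ind := @induced_faces _ i.+1 n.+2 a.
  rewrite ta in ind; have {}ind := induced_trans (ind _ _) inda.
  have tf : tag (faces i.+1 n.+2 a) = i.-1.+1.
    by rewrite tag_faces ta; lia.
  case: (@induced_merge _ i.-1 _ _ _ j tf _ (ind _ _)); try lia.
    by rewrite /= /unbump ltnS (ltnW ji) ltnS ji; lia.
  by move=> v tv ->; rewrite chain_of_degen ?tens0l // tv; lia.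
have ind := @induced_faces _ 0 i b.
rewrite tb in ind; have {}ind := induced_trans (ind _ _) indb.
have tf : tag (faces 0 i b) = (n - i).+1.
  by rewrite tag_faces tb; lia.
case: (@induced_merge _ (n - i)%N _ _ _ (j - i)%N tf _ (ind _ _)); try lia.
  rewrite /= /unbump subn0 subnK //.
  by rewrite ltnn (_ : j < (j - i).+1 + i)%N; lia.
by move=> v tv ->; rewrite chain_of_degen ?tens0r // tv; lia.
Qed.

Definition AW : {linear chain k (sprod X Y) -> tensor (chain k X) (chain k Y)} :=
  chain_lift aw_simplex_degen.

Lemma AWE n (x : X n) (y : Y n) :
  AW (@chain_of k (sprod X Y) (existT (sprod X Y) n (x, y))) =
  \sum_(i < n.+1) tens (@chain_of k X (faces i.+1 n.+1 (existT X n x)))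
                       (@chain_of k Y (faces 0 i (existT Y n y))).
Proof. exact: chain_liftE. Qed.

End AlexanderWhitney.

Section Shuffles.

(* [ab] is a pair of sets $(\alpha, \beta)$ *)
Definition is_shuffle (p q : nat) (ab : {set 'I_(p + q)} * {set 'I_(p + q)}) : bool :=
  [&& ab.1 :&: ab.2 == finset.set0, ab.1 :|: ab.2 == [set: 'I_(p + q)],
      #|ab.1| == p & #|ab.2| == q].

(* the permutation with one-line notation $(\alpha_1,\dots,\beta_1,\dots)$ *)
Definition shuffle_perm m (ab : {set 'I_m} * {set 'I_m}) : 'S_m :=
  insubd (1%g : 'S_m) [ffun i : 'I_m => nth i (enum ab.1 ++ enum ab.2) i].

Lemma shuffle_permE p q (ab : {set 'I_(p + q)} * {set 'I_(p + q)}) (i : 'I_(p + q)) :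
  is_shuffle ab -> shuffle_perm ab i = nth i (enum ab.1 ++ enum ab.2) i.
Proof.
case: ab => a b /and4P[/= /eqP ab0 _ /eqP ap /eqP bq].
have sz : size (enum a ++ enum b) = (p + q)%N by rewrite size_cat -!cardE ap bq.
have un : uniq (enum a ++ enum b).
  rewrite cat_uniq !enum_uniq andbT /=; apply/hasPn => j.
  rewrite !mem_enum => jb; apply/negP => ja.
  by have : j \in a :&: b; [rewrite inE ja jb | rewrite ab0 inE].
rewrite /shuffle_perm -pvalE val_insubd ifT ?ffunE //.
apply/injectiveP => j l; rewrite !ffunE (set_nth_default i) ?sz // => /eqP.
by rewrite (set_nth_default i l) ?sz // nth_uniq ?sz // => /eqP/ord_inj.
Qed.

Lemma belows_eq0 m (a : {set 'I_m}) : belows a 0 = 0%N.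
Proof. by rewrite /belows /below (@eq_count _ _ pred0) ?count_pred0. Qed.

Lemma belows_step m (a : {set 'I_m}) j : (belows a j.+1 <= (belows a j).+1)%N.
Proof.
rewrite /belows below_iotaS; first by rewrite -addn1 leq_add2l leq_b1.
by rewrite (map_inj_uniq val_inj) enum_uniq.
Qed.

Lemma belows_max m (a : {set 'I_m}) j : (m <= j)%N -> belows a j = #|a|.
Proof.
move=> mj; rewrite /belows below_all ?size_map ?cardE //.
by apply/allP => _ /mapP[i _ ->]; apply: leq_trans (ltn_ord i) mj.
Qed.

Lemma belows_shuffle p q (ab : {set 'I_(p + q)} * {set 'I_(p + q)}) j :
  is_shuffle ab -> (j <= p + q)%N -> (belows ab.1 j + belows ab.2 j)%N = j.
Proof.
case: ab => a b sh; have /and4P[/= /eqP ab0 /eqP abT _ _] := sh.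
elim: j => [|j IH] jpq; first by rewrite !belows_eq0.
have us (c : {set 'I_(p + q)}) : uniq [seq val i | i <- enum c].
  by rewrite (map_inj_uniq val_inj) enum_uniq.
rewrite /belows !below_iotaS // -!/(belows _ _).
have jE (c : {set 'I_(p + q)}) :
    (j \in [seq val i | i <- enum c]) = (Ordinal jpq \in c).
  by rewrite -[j]/(val (Ordinal jpq)) (mem_map val_inj) mem_enum.
rewrite !jE addnACA IH 1?ltnW //.
have : Ordinal jpq \in a :|: b by rewrite abT inE.
have : Ordinal jpq \notin a :&: b by rewrite ab0 inE.
rewrite !inE.
by case: (_ \in a); case: (_ \in b) => // _ _; rewrite ?addn0 ?add0n addn1.
Qed.

Lemma nat_step_ivt (c : nat -> nat) m j : c 0%N = 0%N ->
  (forall i, (c i.+1 <= (c i).+1)%N) -> (j < c m)%N ->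
  exists i, [/\ (i < m)%N, c i = j & c i.+1 = j.+1].
Proof.
move=> c0 cS; elim: m => [|m IH]; first by rewrite c0.
case: (ltnP j (c m)) => [/IH[i [im ci cSi]] _|cm jc].
  by exists i; split=> //; apply: leqW.
by exists m; have := cS m; split=> //; lia.
Qed.

End Shuffles.

Section Htilde.
Variables (k : comPzRingType) (X Y : sset).

(* (a, b) for simplices a and b of the same dimension; the other case does not
   occur below, see [htilde_tag1] and [htilde_tag2] *)
Definition chain_pair (a : simplex X) (b : simplex Y) : chain k (sprod X Y) :=
  match tag a =P tag b with
  | ReflectT e =>
      @chain_of k (sprod X Y) (existT (sprod X Y) (tag b) (ecast n (X n) e (tagged a), tagged b))
  | ReflectF _ => 0
  end.

Lemma chain_pairE n (x : X n) (y : Y n) :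
  @chain_pair (existT X n x) (existT Y n y) = @chain_of k (sprod X Y) (existT (sprod X Y) n (x, y)).
Proof. by rewrite /chain_pair /=; case: eqP => // e; rewrite eq_axiomK. Qed.

Lemma chain_pair_degen i a b : tag a = tag b -> (i <= tag a)%N ->
  chain_pair (degen i a) (degen i b) = 0.
Proof.
case: a b => n x [m y] /= nm; case: _ / nm in y * => in_.
rewrite /degen /= chain_pairE.
by rewrite -(@chain_of_degen k (sprod X Y) (existT _ n (x, y)) i).
Qed.

Definition htilde1 (p q : nat) (b : {set 'I_(p + q.+1)}) (x : simplex X) :=
  degens b (faces p.+1 (p + q).+1 x).

Definition htilde2 (p q : nat) (a : {set 'I_(p + q.+1)}) (y : simplex Y) :=
  degen (p + q).+1 (degens a (faces 0 p y)).

Lemma htilde_tag1 p q (b : {set 'I_(p + q.+1)}) (x : simplex X) : (p + q < tag x)%N -> #|b| = q.+1 ->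
  tag (htilde1 b x) = (tag x).+1.
Proof. by move=> pq bq; rewrite tag_degens tag_faces bq; lia. Qed.

Lemma htilde_tag2 p q (a : {set 'I_(p + q.+1)}) (y : simplex Y) : (p + q < tag y)%N -> #|a| = p ->
  tag (htilde2 a y) = (tag y).+1.
Proof. by move=> pq ap; rewrite /= tag_degens tag_faces ap; lia. Qed.

Definition htilde_simplex (t : simplex (sprod X Y)) : chain k (sprod X Y) :=
  \sum_(p < tag t) \sum_(q < tag t | (p + q < tag t)%N)
    \sum_(ab : {set 'I_(p + q.+1)} * {set 'I_(p + q.+1)} | is_shuffle ab)
      (-1) ^+ (p + q + shuffle_perm ab) *:
        chain_pair (htilde1 ab.2 (simplex1 t)) (htilde2 ab.1 (simplex2 t)).

Lemma htilde_term_degen n p q (ab : {set 'I_(p + q.+1)} * {set 'I_(p + q.+1)})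
    j (x : simplex X) (y : simplex Y) : is_shuffle ab ->
  tag x = n -> tag y = n -> (j <= n)%N -> (p + q < n.+1)%N ->
  chain_pair (htilde1 ab.2 (degen j x)) (htilde2 ab.1 (degen j y)) = 0.
Proof.
move=> sh tx ty jn pqn.
have bel l := belows_shuffle sh (j := l).
case: ab sh bel => a b sh /= bel; have /and4P[/= _ _ /eqP ap /eqP bq] := sh.
have amax := @belows_max _ a; have bmax := @belows_max _ b.
rewrite ap in amax; rewrite bq in bmax.
set u := degen j x; set v := degen j y.
have tu : tag u = n.+1 by rewrite /= tx.
have tv : tag v = n.+1 by rewrite /= ty.
have indx : induced u x (unbump j).
  by apply: (induced_degen _ (induced_refl x)); rewrite tx.
have indy : induced v y (unbump j).
  by apply: (induced_degen _ (induced_refl y)); rewrite ty.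
have ind1 : induced (htilde1 b u) x
    (fun l => unbump j (let l' := l - belows b l in
                        if l' < p.+1 then l' else l' + q)%N).
  have fE : induced (faces p.+1 (p + q).+1 u) u
      (fun l => if l < p.+1 then l else l + q)%N.
    apply: induced_ext (@induced_faces _ p.+1 (p + q).+1 u _ _); try lia.
    by move=> l _; case: ltnP; lia.
  have dE := @induced_degens _ _ b (faces p.+1 (p + q).+1 u).
  rewrite tag_faces bq tu in dE.
  by have := induced_trans (induced_trans (dE ltac:(lia)) fE) indx.
have ind2 : induced (htilde2 a v) y
    (fun l => unbump j (let l' := unbump (p + q).+1 l in l' - belows a l' + p)%N).
  have fE : induced (faces 0 p v) v (fun l => l + p)%N.
    apply: induced_ext (@induced_faces _ 0 p v _ _); try lia.
    by move=> l _; rewrite /= subn0.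
  have dE := @induced_degens _ _ a (faces 0 p v).
  rewrite tag_faces ap tv in dE.
  have sE : ((p + q).+1 <= tag (degens a (faces 0 p v)))%N.
    by rewrite tag_degens tag_faces ap tv; lia.
  have := induced_degen sE (induced_refl _).
  by move=> /induced_trans -/(_ _ _ (induced_trans (dE ltac:(lia)) fE))/induced_trans/(_ indy).
have t1 : tag (htilde1 b u) = n.+2 by rewrite htilde_tag1 // tu.
have t2 : tag (htilde2 a v) = n.+2 by rewrite htilde_tag2 // tv.
suff [i [im m1 m2]] : exists i, [/\ (i <= n.+1)%N,
   unbump j (let l' := i - belows b i in if l' < p.+1 then l' else l' + q)%N =
   unbump j (let l' := i.+1 - belows b i.+1 in if l' < p.+1 then l' else l' + q)%N &
   unbump j (let l' := unbump (p + q).+1 i in l' - belows a l' + p)%N =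
   unbump j (let l' := unbump (p + q).+1 i.+1 in l' - belows a l' + p)%N].
  have [u' tu' ->] := induced_merge t1 im ind1 m1.
  have [v' tv' ->] := induced_merge t2 im ind2 m2.
  by apply: chain_pair_degen; rewrite tu' ?tv'.
have ub l : (l <= (p + q).+1)%N -> unbump (p + q).+1 l = l.
  by rewrite /unbump; case: ltnP => //; rewrite subn0.
case: (ltnP j p) => jp.
  have [|i [ipq ci cSi]] := @nat_step_ivt (belows a) (p + q.+1) j (belows_eq0 a) (belows_step a).
    by rewrite amax.
  have b1 := bel i (ltnW ipq); have b2 := bel i.+1 ipq.
  exists i; split; first lia.
    have -> : (i - belows b i = j)%N by lia.
    have -> : (i.+1 - belows b i.+1 = j.+1)%N by lia.
    by rewrite /= !ltnS jp (ltnW jp) /unbump; lia.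
  by rewrite /= !ub; [congr unbump; lia | lia | lia].
case: (ltnP (p + q) j) => jpq.
  exists j.+1; split; first lia.
    rewrite (bmax j.+1) ?(bmax j.+2); [|lia|lia]; rewrite /= /unbump.
    by case: (ltnP (j.+1 - q.+1)); case: (ltnP (j.+2 - q.+1)); lia.
  rewrite /=; have -> : unbump (p + q).+1 j.+2 = j.+1.
    by rewrite /unbump; case: ltnP; lia.
  have -> : unbump (p + q).+1 j.+1 = j by rewrite /unbump; case: ltnP; lia.
  by rewrite (amax j) ?(amax j.+1); [rewrite /unbump|lia|lia]; case: ltnP; case: ltnP; lia.
have [|i [ipq ci cSi]] := @nat_step_ivt (belows b) (p + q.+1) (j - p) (belows_eq0 b) (belows_step b).
  by rewrite bmax //; lia.
have a1 := bel i (ltnW ipq); have a2 := bel i.+1 ipq.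
exists i; split; first lia.
  congr unbump => /=; have -> : (i.+1 - belows b i.+1 = i - belows b i)%N by lia.
  by [].
rewrite /= !ub; [|lia|lia].
have -> : (i - belows a i + p = j)%N by lia.
have -> : (i.+1 - belows a i.+1 + p = j.+1)%N by lia.
by rewrite /unbump ltnn ltnSn subn0 subn1.
Qed.

Fact htilde_simplex_degen t j : (j <= tag t)%N -> htilde_simplex (degen j t) = 0.
Proof.
move=> jt; apply: big1 => p _; apply: big1 => q pq; apply: big1 => ab sh.
rewrite simplex1_degen simplex2_degen.
by rewrite (htilde_term_degen sh erefl) ?scaler0.
Qed.

Definition Htilde : {linear chain k (sprod X Y) -> chain k (sprod X Y)} :=
  chain_lift htilde_simplex_degen.

Lemma HtildeE (t : simplex (sprod X Y)) : Htilde (chain_of k t) = htilde_simplex t.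
Proof. exact: chain_liftE. Qed.

End Htilde.

(* Main.v *)
Require Import Defs.
From HB Require Import structures.
From mathcomp Require Import all_boot all_order all_algebra all_fingroup zify.

Import GRing.Theory.
Local Open Scope ring_scope.

(** Every operator in sight acts on a simplex through a map of vertices, so
that both identities can be read off from such maps. Let $(x,y)$ have
dimension n. In terms of the vertices, the summand of $\tilde H(x,y)$ that
belongs to $(\alpha,\beta)\vdash(p,q+1)$ is a lattice path: step l raises
the first coordinate if $l\in\alpha$ and the second if $l\in\beta$, so that
the path leads from $(0,p)$ to $(p,p+q+1)$ at position p+q+1. Position p+q+2
is $(p+q+1,p+q+1)$, and from there on the path follows the diagonal up to
$(n,n)$. Applying AW after a change of brackets cuts this path at a position
i, with the front part applied to some of the factors and the back part to the
others. Below, a vertex map is a function on natural numbers, related to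
simplices by [induced], and [front i] and [back i] are the front i-face and
the face spanned by the vertices from i on.

Second identity. The last factor Z sees the back part of the second
coordinate. This coordinate takes the value p+q+1 at both positions p+q+1 and
p+q+2, so the cut at i contributes a degenerate simplex of Z unless the first
of these is cut off, that is, unless i >= p+q+2 ([back_htilde2_degenerate]). Then
the front part of the path is the path that the same shuffle defines in
dimension i-1, while the back part is a piece of the diagonal
([front_htilde1], [front_htilde2], [back_htilde2]). These are the summands of
$\tilde H$ of the front (i-1)-face.

First identity. The factor X sees the front part of the first coordinate,
which is constant along each step in $\beta$. So the cut at i contributes
zero unless $0,\dots,i-1$ all lie in $\alpha$
([front_htilde1_degenerate]); in particular i <= p. The shuffles with this
property are those obtained from a shuffle of $(p-i,q+1)$ by prepending i
elements to $\alpha$ ([sum_shuffle_prepend]). The front part is then the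
front i-face of x, and the back part is the path of the shorter shuffle in the
back faces ([front_htilde1_prepend], [back_htilde1_prepend],
[back_htilde2_prepend]). Prepending fixed points does not change the sign of a
permutation ([odd_shuffle_prepend]), so the exponent p+q changes by i and
leaves the factor $(-1)^i$, which is the Koszul sign of $1\otimes\tilde H$ on
a simplex of dimension i. *)

(** * Simplices and their vertex maps *)

Section VertexMaps.
Context {X : sset}.
Implicit Types t u v : simplex X.

(** This turns equalities between composites of simplicial operators into
equalities between functions on natural numbers, where arithmetic decides. *)
Lemma induced_inj {u v t f g} : induced u t f -> induced v t g ->
  tag u = tag v -> (forall j, (j <= tag u)%N -> f j = g j) -> u = v.
Proof.
case: u v => m x [m' y] [th /= -> thE] [th' /= -> thE'] mm fg.
case: _ / mm in y th' thE' *; congr existT.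
by have -> : th = th' by apply: mono_eq => j; rewrite thE thE' fg // -ltnS.
Qed.

(** A simplex is degenerate as soon as its vertex map repeats a value at two
consecutive vertices. *)
Lemma chain_of_merge k u t f i : induced u t f -> (i < tag u)%N ->
  f i = f i.+1 -> chain_of k u = 0.
Proof.
move=> ind iu fi; have tu : tag u = (tag u).-1.+1 by lia.
have [|v tv ->] := induced_merge (i := i) tu _ ind fi; first lia.
by rewrite chain_of_degen ?tv //; lia.
Qed.

Definition front i t := faces i.+1 (tag t).+1 t.
Definition back i t := faces 0 i t.

Lemma tag_front i t : (i <= tag t)%N -> tag (front i t) = i.
Proof. by move=> it; rewrite tag_faces; lia. Qed.

Lemma tag_back i t : tag (back i t) = (tag t - i)%N.
Proof. by rewrite tag_faces subn0. Qed.

Lemma induced_front i t : (i <= tag t)%N -> induced (front i t) t id.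
Proof.
move=> it; apply: induced_ext (induced_faces _ _); [|lia|lia].
by move=> j; rewrite tag_front // ltnS => ->.
Qed.

Lemma induced_back i t : (i <= tag t)%N -> induced (back i t) t (addn^~ i).
Proof.
move=> it; apply: induced_ext (induced_faces _ _); [|lia|lia].
by move=> j _; rewrite /= subn0.
Qed.

(** The first coordinate of the path: $l'$ counts the steps before position l
that are not in $\beta$, and past the corner (p, p+q+1) the q omitted vertices
are skipped. *)
Lemma induced_htilde1 {p q} {b : {set 'I_(p + q.+1)}} {t} :
  (p + q < tag t)%N -> #|b| = q.+1 ->
  induced (htilde1 b t) t (fun l => let l' := (l - belows b l)%N in
                           if (l' <= p)%N then l' else (l' + q)%N).
Proof.
move=> pqt bq.
have fE : induced (faces p.+1 (p + q).+1 t) t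
    (fun l => if (l <= p)%N then l else (l + q)%N).
  apply: induced_ext (induced_faces _ _); [|lia|lia].
  by move=> l _; rewrite ltnS subSS addKn.
have dE := @induced_degens _ _ b (faces p.+1 (p + q).+1 t).
rewrite tag_faces bq in dE.
exact: induced_trans (dE ltac:(lia)) fE.
Qed.

(** The second coordinate of the path: the outer degeneracy repeats position
p+q+1, and what remains counts the steps not in $\alpha$, starting from p. *)
Lemma induced_htilde2 {p q} {a : {set 'I_(p + q.+1)}} {t} :
  (p + q < tag t)%N -> #|a| = p ->
  induced (htilde2 a t) t (fun l => let l' := unbump (p + q).+1 l in
                           (l' - belows a l' + p)%N).
Proof.
move=> pqt ap.
have fE : induced (faces 0 p t) t (addn^~ p) by apply: induced_back; lia.
have dE := @induced_degens _ _ a (faces 0 p t).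
rewrite tag_faces ap in dE.
have sE : ((p + q).+1 <= tag (degens a (faces 0 p t)))%N.
  by rewrite tag_degens tag_faces ap; lia.
exact: induced_trans (induced_degen sE (induced_refl _))
                     (induced_trans (dE ltac:(lia)) fE).
Qed.

End VertexMaps.

(** * Simplices of products *)

Section ProductSimplices.
Context {X Y : sset}.
Implicit Types t : simplex (sprod X Y).

(** The form in which pairs of simplices of equal dimension enter below: the
equality of the dimensions is a hypothesis, and no transport along it has to
be written down. *)
Lemma simplex_pair (a : simplex X) (b : simplex Y) : tag a = tag b ->
  exists t, [/\ simplex1 t = a, simplex2 t = b & tag t = tag a].
Proof.
case: a b => n x [m y] /= nm; case: _ / nm in y *.
by exists (existT (sprod X Y) n (x, y)).
Qed.

Lemma chain_pair_simplex k t : chain_pair k (simplex1 t) (simplex2 t) = chain_of k t.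
Proof. by case: t => n [x y]; rewrite chain_pairE. Qed.

Lemma simplex1_faces p q t : simplex1 (faces p q t) = faces p q (simplex1 t).
Proof. by rewrite /faces; elim: index_iota => //= i r <-; case: foldr => -[|n] []. Qed.

Lemma simplex2_faces p q t : simplex2 (faces p q t) = faces p q (simplex2 t).
Proof. by rewrite /faces; elim: index_iota => //= i r <-; case: foldr => -[|n] []. Qed.

Lemma simplex1_degens m (a : {set 'I_m}) t :
  simplex1 (degens a t) = degens a (simplex1 t).
Proof. by rewrite /degens; elim: (map _ _) t => //= i r IH t; rewrite IH. Qed.

Lemma simplex2_degens m (a : {set 'I_m}) t :
  simplex2 (degens a t) = degens a (simplex2 t).
Proof. by rewrite /degens; elim: (map _ _) t => //= i r IH t; rewrite IH. Qed.

Lemma simplex1_htilde1 p q (b : {set 'I_(p + q.+1)}) t :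
  simplex1 (htilde1 b t) = htilde1 b (simplex1 t).
Proof. by rewrite /htilde1 simplex1_degens simplex1_faces. Qed.

Lemma simplex2_htilde1 p q (b : {set 'I_(p + q.+1)}) t :
  simplex2 (htilde1 b t) = htilde1 b (simplex2 t).
Proof. by rewrite /htilde1 simplex2_degens simplex2_faces. Qed.

Lemma simplex1_htilde2 p q (a : {set 'I_(p + q.+1)}) t :
  simplex1 (htilde2 a t) = htilde2 a (simplex1 t).
Proof. by rewrite /htilde2 simplex1_degen simplex1_degens simplex1_faces. Qed.

Lemma simplex2_htilde2 p q (a : {set 'I_(p + q.+1)}) t :
  simplex2 (htilde2 a t) = htilde2 a (simplex2 t).
Proof. by rewrite /htilde2 simplex2_degen simplex2_degens simplex2_faces. Qed.

End ProductSimplices.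

(** * Alexander-Whitney on pairs *)

Section AWPairs.
Context (k : comPzRingType) {X Y Z : sset}.

Lemma AW_sassoc_pair (a : simplex (sprod X Y)) (b : simplex Z) : tag a = tag b ->
  AW k X (sprod Y Z) (chain_map k (sassoc X Y Z) (chain_pair k a b)) =
  \sum_(i < (tag a).+1) tens (chain_of k (front i (simplex1 a)))
                             (chain_pair k (back i (simplex2 a)) (back i b)).
Proof.
move=> /simplex_pair[t [<- <- tE]].
rewrite chain_pair_simplex chain_liftE chain_liftE /aw_simplex.
apply: eq_bigr => i _; congr tens.
by rewrite -chain_pair_simplex simplex1_faces simplex2_faces.
Qed.

Lemma AW_sassocV_pair (a : simplex X) (b : simplex (sprod Y Z)) : tag a = tag b ->
  AW k (sprod X Y) Z (chain_map k (sassocV X Y Z) (chain_pair k a b)) =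
  \sum_(i < (tag a).+1) tens (chain_pair k (front i a) (front i (simplex1 b)))
                             (chain_of k (back i (simplex2 b))).
Proof.
move=> /simplex_pair[t [<- <- tE]].
rewrite chain_pair_simplex chain_liftE chain_liftE /aw_simplex.
apply: eq_bigr => i _; congr tens.
by rewrite -chain_pair_simplex simplex1_faces simplex2_faces.
Qed.

End AWPairs.

(** * Shuffles *)

Section PrependAlpha.

Definition shuffle_cons {m} (ab : {set 'I_m} * {set 'I_m}) :
    {set 'I_m.+1} * {set 'I_m.+1} :=
  (ord0 |: lift ord0 @: ab.1, lift ord0 @: ab.2).

Lemma mem_lift0 m (a : {set 'I_m}) j : (lift ord0 j \in lift ord0 @: a) = (j \in a).
Proof. exact: (mem_imset _ _ (@lift_inj _ _)). Qed.

Lemma mem0_lift m (a : {set 'I_m}) : (ord0 \in lift ord0 @: a) = false.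
Proof. by apply/imsetP => -[j _ /eqP]; rewrite (negPf (neq_lift _ _)). Qed.

Lemma enum_setE (T : finType) (A : {set T}) : enum A = [seq x <- enum T | x \in A].
Proof. by rewrite enumT. Qed.

Lemma enum_lift m (a : {set 'I_m}) :
  enum (lift ord0 @: a) = [seq lift ord0 i | i <- enum a].
Proof.
rewrite !enum_setE enum_ordSl /= mem0_lift filter_map; congr map.
by apply: eq_filter => j; apply: mem_lift0.
Qed.

Lemma enum_cons m (a : {set 'I_m}) :
  enum (ord0 |: lift ord0 @: a) = ord0 :: [seq lift ord0 i | i <- enum a].
Proof.
rewrite !enum_setE enum_ordSl /= setU11 filter_map; congr (_ :: map _ _).
by apply: eq_filter => j; rewrite /= in_setU1 mem_lift0.
Qed.

Lemma belows_cons1 m (ab : {set 'I_m} * {set 'I_m}) j :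
  belows (shuffle_cons ab).1 j.+1 = (belows ab.1 j).+1.
Proof. by rewrite /belows enum_cons /below /= !count_map. Qed.

Lemma belows_cons2 m (ab : {set 'I_m} * {set 'I_m}) j :
  belows (shuffle_cons ab).2 j.+1 = belows ab.2 j.
Proof. by rewrite /belows enum_lift /below !count_map. Qed.

Lemma is_shuffleE {p q} (ab : {set 'I_(p + q)} * {set 'I_(p + q)}) :
  is_shuffle ab = [&& ab.2 == ~: ab.1, #|ab.1| == p & #|ab.2| == q].
Proof.
case: ab => a b; rewrite /is_shuffle /= andbA; congr (_ && _); apply/andP/eqP.
  move=> [/eqP ab0 /eqP abT]; apply/setP => j.
  move/setP/(_ j): ab0; move/setP/(_ j): abT; rewrite !inE.
  by case: (j \in a); case: (j \in b).
by move=> ->; rewrite setICr setUCr.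
Qed.

Lemma shuffle_cards {p q} {ab : {set 'I_(p + q)} * {set 'I_(p + q)}} :
  is_shuffle ab -> #|ab.1| = p /\ #|ab.2| = q.
Proof. by rewrite is_shuffleE => /and3P[_ /eqP ? /eqP ?]. Qed.

Lemma is_shuffle_cons {p q} (ab : {set 'I_(p + q)} * {set 'I_(p + q)}) :
  @is_shuffle p.+1 q (shuffle_cons ab) = is_shuffle ab.
Proof.
rewrite !is_shuffleE /= cardsU1 mem0_lift !(card_imset _ (@lift_inj _ _)) add1n eqSS.
congr (_ && _).
suff -> : ~: (ord0 |: lift ord0 @: ab.1) = lift ord0 @: (~: ab.1).
  exact: (inj_eq (imset_inj (@lift_inj _ _))).
apply/setP => j; case: (unliftP ord0 j) => [l|] ->.
  by rewrite mem_lift0 !inE mem_lift0 eq_sym (negPf (neq_lift _ _)).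
by rewrite mem0_lift !inE eqxx.
Qed.

(** In one-line notation, a fixed point is prepended and the rest is shifted. *)
Lemma shuffle_perm_cons {p q} (ab : {set 'I_(p + q)} * {set 'I_(p + q)}) :
  is_shuffle ab ->
  shuffle_perm (shuffle_cons ab) = lift_perm ord0 ord0 (shuffle_perm ab).
Proof.
move=> sh; have sh' := sh; rewrite -is_shuffle_cons in sh'.
have [ap bq] := shuffle_cards sh.
apply/permP => j; rewrite (shuffle_permE (p := p.+1)) //= enum_cons enum_lift /=.
case: (unliftP ord0 j) => [l|] ->; last by rewrite lift_perm_id.
rewrite lift_perm_lift shuffle_permE // -map_cat /= (nth_map l) //.
by rewrite size_cat -!cardE ap bq; apply: ltn_ord.
Qed.

(** The shuffles of (p+1, q) with 0 in $\alpha$ correspond to the shuffles of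
(p, q), by taking preimages under the shift. *)
Lemma sum_shuffle_cons {V : nmodType} {p q} (F : _ -> V) :
  (forall ab, @is_shuffle p.+1 q ab -> ord0 \in ab.2 -> F ab = 0) ->
  \sum_(ab | @is_shuffle p.+1 q ab) F ab =
  \sum_(ab | @is_shuffle p q ab) F (shuffle_cons ab).
Proof.
move=> F0; rewrite (bigID (fun ab : {set 'I_(p + q).+1} * _ => ord0 \in ab.1)) /=.
rewrite addrC big1 ?add0r.
  pose g (ab : {set 'I_(p + q).+1} * {set 'I_(p + q).+1}) :=
    ((lift ord0 @^-1: ab.1)%SET, (lift ord0 @^-1: ab.2)%SET).
  rewrite (reindex_onto (@shuffle_cons _) g) /=.
    apply: eq_bigl => ab; rewrite is_shuffle_cons setU11 andbT.
    suff -> : g (shuffle_cons ab) = ab by rewrite eqxx andbT.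
    by case: ab => a b; congr (_, _); apply/setP => j; rewrite !inE mem_lift0.
  move=> [a b] /andP[/=]; rewrite is_shuffleE /= => /and3P[/eqP -> _ _] a0.
  congr (_, _); apply/setP => j; case: (unliftP ord0 j) => [l|] ->.
  - by rewrite !inE mem_lift0 eq_sym (negPf (neq_lift _ _)) !inE.
  - by rewrite !inE a0.
  - by rewrite mem_lift0 !inE.
  - by rewrite mem0_lift !inE a0.
move=> [a b] /= /andP[sh a0]; apply: F0 => //.
by move: sh; rewrite is_shuffleE /= => /and3P[/eqP -> _ _]; rewrite inE.
Qed.

(** By recursion on i the types match by computation, since i.+1 + p + q reduces
to (i + p + q).+1; a direct definition through a shift by i would need casts
between index types. *)
Fixpoint shuffle_prepend i {p q} :
    {set 'I_(p + q)} * {set 'I_(p + q)} ->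
    {set 'I_(i + p + q)} * {set 'I_(i + p + q)} :=
  match i with
  | 0 => id
  | j.+1 => fun ab => shuffle_cons (shuffle_prepend j ab)
  end.

Lemma is_shuffle_prepend i {p q} (ab : {set 'I_(p + q)} * {set 'I_(p + q)}) :
  @is_shuffle (i + p) q (shuffle_prepend i ab) = is_shuffle ab.
Proof. by elim: i => //= i <-; rewrite is_shuffle_cons. Qed.

Lemma odd_shuffle_prepend i {p q} (ab : {set 'I_(p + q)} * {set 'I_(p + q)}) :
  is_shuffle ab ->
  odd_perm (shuffle_perm (shuffle_prepend i ab)) = odd_perm (shuffle_perm ab).
Proof.
move=> sh; elim: i => //= i <-.
by rewrite shuffle_perm_cons ?is_shuffle_prepend // odd_lift_perm.
Qed.

Lemma belows_prepend1 i {p q} (ab : {set 'I_(p + q)} * {set 'I_(p + q)}) j :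
  belows (shuffle_prepend i ab).1 (i + j) = (i + belows ab.1 j)%N.
Proof. by elim: i => // i IH; apply: etrans (belows_cons1 _ _ _) (congr1 S IH). Qed.

Lemma belows_prepend2 i {p q} (ab : {set 'I_(p + q)} * {set 'I_(p + q)}) j :
  belows (shuffle_prepend i ab).2 (i + j) = belows ab.2 j.
Proof. by elim: i => // i IH; apply: etrans (belows_cons2 _ _ _) IH. Qed.

Lemma belows_prepend_small i {p q} (ab : {set 'I_(p + q)} * {set 'I_(p + q)}) j :
  (j <= i)%N -> belows (shuffle_prepend i ab).2 j = 0%N.
Proof.
elim: i j => [|i IH] [|j] ji; rewrite ?belows_eq0 //.
exact: etrans (belows_cons2 _ _ _) (IH _ ji).
Qed.

(** The condition that $\beta$ meets $\{0,\dots,i-1\}$ is expressed by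
counting, as this is what the vertex maps depend on. *)
Lemma sum_shuffle_prepend i {V : nmodType} {p q} (F : _ -> V) :
  (forall ab, @is_shuffle (i + p) q ab -> (0 < belows ab.2 i)%N -> F ab = 0) ->
  \sum_(ab | @is_shuffle (i + p) q ab) F ab =
  \sum_(ab | @is_shuffle p q ab) F (shuffle_prepend i ab).
Proof.
elim: i F => [//|i IH] F F0; rewrite (@sum_shuffle_cons V (i + p)).
  rewrite (IH (F \o shuffle_cons)) // => ab sh bi; apply: F0.
    by rewrite is_shuffle_cons.
  by rewrite belows_cons2.
move=> ab sh b0; apply: F0 => //; rewrite /belows /below -has_count.
by apply/hasP; exists 0%N => //; apply/mapP; exists ord0; rewrite ?mem_enum.
Qed.

End PrependAlpha.

Lemma belows_leq m (a : {set 'I_m}) j : (belows a j <= #|a|)%N.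
Proof. by rewrite cardE -(size_map val); apply: count_size. Qed.

(** At most p of the first i elements can lie in $\alpha$. *)
Lemma belows_beta_gt0 {p q} {ab : {set 'I_(p + q.+1)} * {set 'I_(p + q.+1)}} i :
  is_shuffle ab -> (p < i)%N -> (0 < belows ab.2 i)%N.
Proof.
move=> sh pi; have [ap bq] := shuffle_cards sh.
case: (leqP i (p + q.+1)) => ipq; last by rewrite belows_max ?bq // ltnW.
have := belows_shuffle sh ipq; have := belows_leq _ ab.1 i.
by rewrite ap; lia.
Qed.

(** * How the homotopy meets the front and back faces *)

Section Faces.
Context {X : sset}.
Implicit Types x : simplex X.

Section Split.
Context {p q : nat} {ab : {set 'I_(p + q.+1)} * {set 'I_(p + q.+1)}}.
Hypothesis sh : is_shuffle ab.

(** At a $\beta$-step before position i the first coordinate stays constant. *)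
Lemma front_htilde1_degenerate k x i : (p + q < tag x)%N ->
  (i <= (tag x).+1)%N -> (0 < belows ab.2 i)%N ->
  chain_of k (front i (htilde1 ab.2 x)) = 0.
Proof.
move=> pqx ix bi; have [_ bq] := shuffle_cards sh.
have [l [li bl bSl]] := nat_step_ivt (belows_eq0 ab.2) (belows_step ab.2) bi.
have ti : (i <= tag (htilde1 ab.2 x))%N by rewrite htilde_tag1.
have ind := induced_trans (induced_front i _ ti) (induced_htilde1 pqx bq).
apply: (chain_of_merge _ _ _ _ l ind); first by rewrite tag_front.
by rewrite /= bl bSl; congr (if _ then _ else _); lia.
Qed.

(** The repeated value at the positions p+q+1 and p+q+2 lies in the back part. *)
Lemma back_htilde2_degenerate k x i : (p + q < tag x)%N -> (i <= (p + q).+1)%N ->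
  chain_of k (back i (htilde2 ab.1 x)) = 0.
Proof.
move=> pqx ipq; have [ap _] := shuffle_cards sh.
have ti : (i <= tag (htilde2 ab.1 x))%N by rewrite htilde_tag2 //; lia.
have ind := induced_trans (induced_back i _ ti) (induced_htilde2 pqx ap).
apply: (chain_of_merge _ _ _ _ ((p + q).+1 - i)%N ind).
  by rewrite tag_back htilde_tag2 //; lia.
rewrite /= addSn subnK // /unbump ltnn ltnSn subn0 subn1 //.
Qed.

(** The formula for the vertex map does not involve the dimension, so cutting
the path after a piece of the diagonal gives the path for the front face. *)
Lemma front_htilde1 x i : (p + q < i)%N -> (i <= tag x)%N ->
  front i.+1 (htilde1 ab.2 x) = htilde1 ab.2 (front i x).
Proof.
move=> pqi ix; have [_ bq] := shuffle_cards sh.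
have pqx : (p + q < tag x)%N by lia.
have pqf : (p + q < tag (front i x))%N by rewrite tag_front.
have ti : (i.+1 <= tag (htilde1 ab.2 x))%N by rewrite htilde_tag1.
apply: (induced_inj (induced_trans (induced_front _ _ ti) (induced_htilde1 pqx bq))
                    (induced_trans (induced_htilde1 pqf bq) (induced_front i x ix))) => //.
by rewrite htilde_tag1 // !tag_front.
Qed.

Lemma front_htilde2 x i : (p + q < i)%N -> (i <= tag x)%N ->
  front i.+1 (htilde2 ab.1 x) = htilde2 ab.1 (front i x).
Proof.
move=> pqi ix; have [ap _] := shuffle_cards sh.
have pqx : (p + q < tag x)%N by lia.
have pqf : (p + q < tag (front i x))%N by rewrite tag_front.
have ti : (i.+1 <= tag (htilde2 ab.1 x))%N by rewrite htilde_tag2.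
apply: (induced_inj (induced_trans (induced_front _ _ ti) (induced_htilde2 pqx ap))
                    (induced_trans (induced_htilde2 pqf ap) (induced_front i x ix))) => //.
by rewrite htilde_tag2 // !tag_front.
Qed.

(** Past position p+q+1 the path is the diagonal, one position late. *)
Lemma back_htilde2 x i : (p + q < i)%N -> (i <= tag x)%N ->
  back i.+1 (htilde2 ab.1 x) = back i x.
Proof.
move=> pqi ix; have [ap _] := shuffle_cards sh.
have pqx : (p + q < tag x)%N by lia.
have ti : (i.+1 <= tag (htilde2 ab.1 x))%N by rewrite htilde_tag2.
apply: (induced_inj (induced_trans (induced_back _ _ ti) (induced_htilde2 pqx ap))
                    (induced_back i x ix)).
  by rewrite !tag_back htilde_tag2.
move=> j _ /=.
have -> : unbump (p + q).+1 (j + i.+1) = (j + i)%N by rewrite /unbump; lia.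
by rewrite belows_max ?ap; lia.
Qed.

Section Prepend.
Variables (i : nat) (x : simplex X).
Hypothesis ipqx : (i + p + q < tag x)%N.

Let cards : #|(shuffle_prepend i ab).1| = (i + p)%N /\
            #|(shuffle_prepend i ab).2| = q.+1.
Proof. by apply: shuffle_cards; rewrite is_shuffle_prepend. Qed.

Let ix : (i <= tag x)%N. Proof. by lia. Qed.

Let pqb : (p + q < tag (back i x))%N. Proof. by rewrite tag_back; lia. Qed.

(** Along initial $\alpha$-steps the first coordinate is the identity. *)
Lemma front_htilde1_prepend :
  front i (htilde1 (p := i + p) (shuffle_prepend i ab).2 x) = front i x.
Proof.
have [_ bq] := cards.
have ti : (i <= tag (htilde1 (p := i + p) (shuffle_prepend i ab).2 x))%N.
  by rewrite htilde_tag1 // leqW.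
apply: (induced_inj (induced_trans (induced_front _ _ ti) (induced_htilde1 ipqx bq))
                    (induced_front i x ix)).
  by rewrite !tag_front.
move=> j; rewrite tag_front // => ji.
by rewrite /= belows_prepend_small // subn0; case: leqP; lia.
Qed.

(** After i initial $\alpha$-steps, what is left is the path of the shorter
shuffle with both coordinates moved by i, hence a path in the back faces. *)
Lemma back_htilde1_prepend :
  back i (htilde1 (p := i + p) (shuffle_prepend i ab).2 x) = htilde1 ab.2 (back i x).
Proof.
have [_ bq] := cards; have [_ bq'] := shuffle_cards sh.
have ti : (i <= tag (htilde1 (p := i + p) (shuffle_prepend i ab).2 x))%N.
  by rewrite htilde_tag1 // leqW.
apply: (induced_inj (induced_trans (induced_back _ _ ti) (induced_htilde1 ipqx bq))
                    (induced_trans (induced_htilde1 pqb bq') (induced_back i x ix))).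
  by rewrite tag_back !htilde_tag1 // tag_back; lia.
move=> j _; rewrite /= [(j + i)%N]addnC belows_prepend2.
have bj : (belows ab.2 j <= j)%N.
  elim: j => [|j IH]; first by rewrite belows_eq0.
  by have := belows_step ab.2 j; lia.
by case: leqP => ?; case: leqP => ?; lia.
Qed.

Lemma back_htilde2_prepend :
  back i (htilde2 (p := i + p) (shuffle_prepend i ab).1 x) = htilde2 ab.1 (back i x).
Proof.
have [ap _] := cards; have [ap' _] := shuffle_cards sh.
have ti : (i <= tag (htilde2 (p := i + p) (shuffle_prepend i ab).1 x))%N.
  by rewrite htilde_tag2 // leqW.
apply: (induced_inj (induced_trans (induced_back _ _ ti) (induced_htilde2 ipqx ap))
                    (induced_trans (induced_htilde2 pqb ap') (induced_back i x ix))).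
  by rewrite tag_back !htilde_tag2 // tag_back; lia.
move=> j _; rewrite /=.
have -> : unbump (i + p + q).+1 (j + i) = (i + unbump (p + q).+1 j)%N.
  by rewrite /unbump; lia.
by rewrite belows_prepend1; lia.
Qed.

End Prepend.
End Split.
End Faces.

(** * Comparison of the two sides *)

Section TensorSums.
Context {k : comPzRingType} {M N : lmodType k}.

Lemma tens_suml {I : Type} (r : seq I) (P : pred I) (F : I -> M) (n : N) :
  tens (\sum_(i <- r | P i) F i) n = \sum_(i <- r | P i) tens (F i) n.
Proof. by apply: (big_morph (fun m => tens m n)) => [? ?|]; rewrite ?tensDl ?tens0l. Qed.

Lemma tens_sumr {I : Type} (r : seq I) (P : pred I) (m : M) (F : I -> N) :
  tens m (\sum_(i <- r | P i) F i) = \sum_(i <- r | P i) tens m (F i).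
Proof. by apply: (big_morph (fun n => tens m n)) => [? ?|]; rewrite ?tensDr ?tens0r. Qed.

End TensorSums.

(** Ranges for p and q that may exceed the dimension let the sums for a simplex
and for its faces be compared term by term. *)
Lemma htilde_simplexE k {X Y : sset} (t : simplex (sprod X Y)) N M :
  (tag t <= N)%N -> (tag t <= M)%N ->
  htilde_simplex k t =
  \sum_(0 <= p < N) \sum_(0 <= q < M | (p + q < tag t)%N)
    \sum_(ab | @is_shuffle p q.+1 ab)
      (-1) ^+ (p + q + shuffle_perm ab) *:
        chain_pair k (htilde1 ab.2 (simplex1 t)) (htilde2 ab.1 (simplex2 t)).
Proof.
move=> tN tM; rewrite /htilde_simplex.
rewrite -(big_mkord predT (fun p => \sum_(q < tag t | (p + q < tag t)%N)
    \sum_(ab | @is_shuffle p q.+1 ab)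
      (-1) ^+ (p + q + shuffle_perm ab) *:
        chain_pair k (htilde1 ab.2 (simplex1 t)) (htilde2 ab.1 (simplex2 t)))).
rewrite (big_nat_widen _ _ _ _ _ tN) big_mkcondr /=; apply: eq_bigr => p _.
rewrite -(big_mkord (fun q => (p + q < tag t)%N) (fun q =>
    \sum_(ab | @is_shuffle p q.+1 ab)
      (-1) ^+ (p + q + shuffle_perm ab) *:
        chain_pair k (htilde1 ab.2 (simplex1 t)) (htilde2 ab.1 (simplex2 t)))).
rewrite (big_nat_widen _ _ _ _ _ tM).
case: ltnP => tp; last by rewrite big1 // => q; lia.
by apply: eq_bigl => q; apply/andb_idr; lia.
Qed.

Lemma exchange_htilde_sum {V : nmodType} N M n m
    (F : forall p q, {set 'I_(p + q.+1)} * {set 'I_(p + q.+1)} -> 'I_m -> V) :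
  \sum_(0 <= p < N) \sum_(0 <= q < M | (p + q < n)%N)
    \sum_(ab | @is_shuffle p q.+1 ab) \sum_(i < m) F p q ab i =
  \sum_(i < m) \sum_(0 <= p < N) \sum_(0 <= q < M | (p + q < n)%N)
    \sum_(ab | @is_shuffle p q.+1 ab) F p q ab i.
Proof.
rewrite [RHS]exchange_big /=; apply: eq_bigr => p _.
rewrite [RHS]exchange_big /=; apply: eq_bigr => q _.
by rewrite exchange_big.
Qed.

(** The terms of the first identity that come from the cut at i: only the
shuffles for which $0,\dots,i-1$ all lie in $\alpha$ survive on the left, and
p is replaced by i + p. The cut at the very end is included, where the right side is empty. *)
Lemma sum_front_back_htilde k {X Y Z : sset}
    (xy : simplex (sprod X Y)) (z : simplex Z) i :
  tag xy = tag z -> (i <= (tag z).+1)%N ->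
  \sum_(0 <= p < tag z) \sum_(0 <= q < tag z | (p + q < tag z)%N)
    \sum_(ab | @is_shuffle p q.+1 ab)
      (-1) ^+ (p + q + shuffle_perm ab) *:
        tens (chain_of k (front i (htilde1 ab.2 (simplex1 xy))))
             (chain_pair k (back i (htilde1 ab.2 (simplex2 xy)))
                           (back i (htilde2 ab.1 z))) =
  \sum_(0 <= p < tag z - i) \sum_(0 <= q < tag z | (p + q < tag z - i)%N)
    \sum_(ab | @is_shuffle p q.+1 ab)
      (-1) ^+ (i + (p + q + shuffle_perm ab)) *:
        tens (chain_of k (front i (simplex1 xy)))
             (chain_pair k (htilde1 ab.2 (back i (simplex2 xy)))
                           (htilde2 ab.1 (back i z))).
Proof.
set n := tag z => xyn ilen.
pose T p q (ab : {set 'I_(p + q.+1)} * {set 'I_(p + q.+1)}) :=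
  (-1) ^+ (p + q + shuffle_perm ab) *:
    tens (chain_of k (front i (htilde1 ab.2 (simplex1 xy))))
         (chain_pair k (back i (htilde1 ab.2 (simplex2 xy)))
                       (back i (htilde2 ab.1 z))).
have T0 p q ab : (p + q < n)%N -> @is_shuffle p q.+1 ab ->
    (0 < belows ab.2 i)%N -> T p q ab = 0.
  move=> pqn sh bi; rewrite /T (front_htilde1_degenerate sh) ?tens0l ?scaler0 //=.
    by rewrite xyn.
  by rewrite xyn.
(* The summands with p < i vanish; i = n + 1 is possible, hence the minimum. *)
rewrite (@big_cat_nat _ _ _ (minn i n)) //= ?geq_minr // [X in X + _]big1_seq ?add0r.
  rewrite -{1}[minn i n]add0n big_addn (_ : n - minn i n = n - i)%N; last by lia.
  rewrite big_nat_cond [RHS]big_nat_cond; apply: eq_bigr => p /andP[/andP[_ pni] _].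
  have -> : minn i n = i by lia.
  rewrite addnC; apply: eq_big => [q|q pqn]; first by lia.
  rewrite (@sum_shuffle_prepend i) => [|ab sh bi]; last exact: T0.
  apply: eq_bigr => ab sh.
  rewrite odd_shuffle_prepend // front_htilde1_prepend //; last by rewrite /= xyn.
  rewrite back_htilde1_prepend ?back_htilde2_prepend //; last by rewrite /= xyn.
  by rewrite !addnA.
move=> p /andP[_]; rewrite mem_index_iota => /andP[_ pin].
apply: big1 => q pqn; apply: big1 => ab sh; apply: T0 => //.
by apply: belows_beta_gt0 => //; lia.
Qed.

Lemma AW_sassoc_Htilde k (X Y Z : sset) t :
  AW k X (sprod Y Z)
    (chain_map k (sassoc X Y Z) (Htilde k (sprod X Y) Z (chain_of k t))) =
  koszul 1 (idfun : {linear chain k X -> chain k X}) (Htilde k Y Z)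
    (AW k X (sprod Y Z) (chain_map k (sassoc X Y Z) (chain_of k t))).
Proof.
set n := tag t; have t1 : tag (simplex1 t) = n by [].
have t2 : tag (simplex2 t) = n by [].
rewrite HtildeE (@htilde_simplexE k _ _ t n n) //.
rewrite -[chain_of k t]chain_pair_simplex AW_sassoc_pair //.
rewrite [RHS](linear_sum
  (koszul 1 (idfun : {linear chain k X -> chain k X}) (Htilde k Y Z))).
(* An abstract name keeps AW from being unfolded to the underlying lifts when
   linearity is used. *)
have [f fE] : exists f : {linear chain k (sprod (sprod X Y) Z) ->
    tensor (chain k X) (chain k (sprod Y Z))},
    forall c, AW k X (sprod Y Z) (chain_map k (sassoc X Y Z) c) = f c.
  by exists (AW k X (sprod Y Z) \o chain_map k (sassoc X Y Z)).
rewrite fE linear_sum.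
transitivity (\sum_(i < n.+2) \sum_(0 <= p < n - i) \sum_(0 <= q < n | (p + q < n - i)%N)
    \sum_(ab | @is_shuffle p q.+1 ab)
      (-1) ^+ (i + (p + q + shuffle_perm ab)) *:
        tens (chain_of k (front i (simplex1 (simplex1 t))))
             (chain_pair k (htilde1 ab.2 (back i (simplex2 (simplex1 t))))
                           (htilde2 ab.1 (back i (simplex2 t))))).
  rewrite -(eq_bigr _ (fun (i : 'I_n.+2) _ =>
    @sum_front_back_htilde k _ _ _ (simplex1 t) (simplex2 t) i erefl (ltn_ord i))).
  rewrite -exchange_htilde_sum; apply: eq_bigr => p _; rewrite linear_sum.
  apply: eq_bigr => q pqn; rewrite linear_sum; apply: eq_bigr => ab sh.
  have [ap bq] := shuffle_cards sh.
  have tt : tag (htilde1 ab.2 (simplex1 t)) = n.+1 by rewrite htilde_tag1.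
  rewrite linearZ /= -fE AW_sassoc_pair ?htilde_tag2 // scaler_sumr tt.
  by apply: eq_bigr => i _; rewrite simplex1_htilde1 simplex2_htilde1.
(* On the left the cut may also be at n + 1, where the sum over p is empty. *)
rewrite [LHS]big_ord_recr [LHS]/= [X in _ + X]big_geq ?addr0; last by lia.
apply: eq_bigr => i _.
have it : (i <= n)%N by rewrite -ltnS.
have [|w [w1 w2 tw]] :=
  simplex_pair (back i (simplex2 (simplex1 t))) (back i (simplex2 t)).
  by rewrite !tag_back.
rewrite -w1 -w2 chain_pair_simplex koszulE tag_front // HtildeE.
have twn : tag w = (n - i)%N by rewrite tw tag_back.
rewrite (@htilde_simplexE k _ _ w (n - i) n) ?twn ?leq_subr //.
rewrite mul1n tens_sumr scaler_sumr; apply: eq_bigr => p _.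
rewrite tens_sumr scaler_sumr; apply: eq_bigr => q _.
rewrite tens_sumr scaler_sumr; apply: eq_bigr => ab _.
by rewrite tensZr scalerA -exprD w1 w2.
Qed.

Lemma AW_sassocV_Htilde k (X Y Z : sset) t :
  AW k (sprod X Y) Z
    (chain_map k (sassocV X Y Z) (Htilde k X (sprod Y Z) (chain_of k t))) =
  koszul 0 (Htilde k X Y) (idfun : {linear chain k Z -> chain k Z})
    (AW k (sprod X Y) Z (chain_map k (sassocV X Y Z) (chain_of k t))).
Proof.
set n := tag t; have t1 : tag (simplex1 t) = n by [].
have t2 : tag (simplex2 t) = n by [].
rewrite HtildeE (@htilde_simplexE k _ _ t n n) //.
rewrite -[chain_of k t]chain_pair_simplex AW_sassocV_pair //.
rewrite [RHS](linear_sum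
  (koszul 0 (Htilde k X Y) (idfun : {linear chain k Z -> chain k Z}))).
(* An abstract name keeps AW from being unfolded to the underlying lifts when
   linearity is used. *)
have [f fE] : exists f : {linear chain k (sprod X (sprod Y Z)) ->
    tensor (chain k (sprod X Y)) (chain k Z)},
    forall c, AW k (sprod X Y) Z (chain_map k (sassocV X Y Z) c) = f c.
  by exists (AW k (sprod X Y) Z \o chain_map k (sassocV X Y Z)).
rewrite fE linear_sum.
transitivity (\sum_(i < n.+2) \sum_(0 <= p < n) \sum_(0 <= q < n | (p + q < n)%N)
    \sum_(ab | @is_shuffle p q.+1 ab)
      (-1) ^+ (p + q + shuffle_perm ab) *:
        tens (chain_pair k (front i (htilde1 ab.2 (simplex1 t)))
                           (front i (htilde2 ab.1 (simplex1 (simplex2 t)))))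
             (chain_of k (back i (htilde2 ab.1 (simplex2 (simplex2 t)))))).
  rewrite -exchange_htilde_sum; apply: eq_bigr => p _; rewrite linear_sum.
  apply: eq_bigr => q pqn; rewrite linear_sum; apply: eq_bigr => ab sh.
  have [ap bq] := shuffle_cards sh.
  have tt : tag (htilde1 ab.2 (simplex1 t)) = n.+1 by rewrite htilde_tag1.
  rewrite linearZ /= -fE AW_sassocV_pair ?htilde_tag2 // scaler_sumr tt.
  by apply: eq_bigr => i _; rewrite simplex1_htilde2 simplex2_htilde2.
(* The cut at 0 contributes nothing, and the cut at i + 1 on the left matches
   the cut at i on the right. *)
rewrite big_ord_recl [X in X + _]big1 ?add0r => [|p _]; last first.
  apply: big1 => q pqn; apply: big1 => ab sh.
  by rewrite back_htilde2_degenerate // tens0r scaler0.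
apply: eq_bigr => i _.
have it : (i <= n)%N by rewrite -ltnS.
have [|w [w1 w2 tw]] :=
  simplex_pair (front i (simplex1 t)) (front i (simplex1 (simplex2 t))).
  by rewrite !tag_front.
rewrite -w1 -w2 chain_pair_simplex koszulE scale1r HtildeE.
have twn : tag w = i by rewrite tw tag_front.
rewrite (@htilde_simplexE k _ _ w n n) ?twn // !lift0.
rewrite tens_suml; apply: eq_bigr => p _.
rewrite tens_suml big_mkcond [RHS]big_mkcond; apply: eq_bigr => q _ /=.
case: (ltnP (p + q) i) => pqi; last first.
  case: ifP => // pqn; apply: big1 => ab sh.
  by rewrite back_htilde2_degenerate // tens0r scaler0.
rewrite (leq_trans pqi it) tens_suml; apply: eq_bigr => ab sh.
by rewrite front_htilde1 // front_htilde2 // back_htilde2 // w1 w2 tensZl.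
Qed.

(** Stated for abstract linear maps, because checking that composites of the
concrete ones agree with their values on generators by conversion unfolds the
quotient constructions. *)
Lemma chain_comp3_eq {k : comPzRingType} {W : sset} {L M N P Q : lmodType k}
    (f1 : {linear chain k W -> L}) (f2 : {linear L -> M}) (f3 : {linear M -> N})
    (g1 : {linear chain k W -> P}) (g2 : {linear P -> Q}) (g3 : {linear Q -> N}) :
  (forall t, f3 (f2 (f1 (chain_of k t))) = g3 (g2 (g1 (chain_of k t)))) ->
  f3 \o f2 \o f1 =1 g3 \o g2 \o g1.
Proof. by move=> fg; apply: chain_hom_eq => t; apply: fg. Qed.

Theorem proposition4p5 (k : comPzRingType) (X Y Z : sset) :
  (AW k X (sprod Y Z) \o chain_map k (sassoc X Y Z) \o Htilde k (sprod X Y) Z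
   =1 koszul 1 (idfun : {linear chain k X -> chain k X}) (Htilde k Y Z)
        \o AW k X (sprod Y Z) \o chain_map k (sassoc X Y Z))
  /\
  (AW k (sprod X Y) Z \o chain_map k (sassocV X Y Z) \o Htilde k X (sprod Y Z)
   =1 koszul 0 (Htilde k X Y) (idfun : {linear chain k Z -> chain k Z})
        \o AW k (sprod X Y) Z \o chain_map k (sassocV X Y Z)).
Proof.
split; apply: chain_comp3_eq => t.
  exact: AW_sassoc_Htilde.
exact: AW_sassocV_Htilde.
Qed.
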